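(* Let $p$ be a prime and $F\colon\mathbb F_p^n\to\mathbb F_p^n$ a $t$-plateaued function for some $t>0$. Then its differential uniformity $\delta$ satisfies $\delta\ge p^t$. Moreover, $\delta=p^t$ if and only if for every nonzero $a$ and every $b$ the equation $F(x+a)-F(x)=b$ has either $0$ or $p^t$ solutions $x\in\mathbb F_p^n$.
   Context: Standard scalar product, $\zeta_p=e^{2\pi i/p}$. For $f\colon\mathbb F_p^n\to\mathbb F_p$, $W_f(a)=\sum_x\zeta_p^{f(x)-\langle a,x\rangle}$; $f$ is $t$-plateaued if $|W_f(a)|\in\{0,p^{(n+t)/2}\}$ for all $a$. $F$ is $t$-plateaued if all components $F_b(x)=\langle b,F(x)\rangle$, $b\ne0$, are $t$-plateaued. The differential uniformity $\delta$ of $F$ is the maximum over $a\ne0$ and all $b$ of the number of solutions $x$ of $F(x+a)-F(x)=b$. *)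

(* Defs.v *)
From mathcomp Require Import all_boot all_order all_algebra.
From mathcomp Require Import complex.
From mathcomp Require Import reals exp trigo.

Set Implicit Arguments.
Unset Strict Implicit.
Unset Printing Implicit Defensive.

Import Order.TTheory GRing.Theory Num.Theory.
Import ComplexField.Normc.

Local Open Scope ring_scope.
Local Open Scope complex_scope.

Definition zeta (R : realType) (p : nat) : R[i] :=
  cos (2 * pi / p%:R) +i* sin (2 * pi / p%:R).

Definition scalar_product (p n : nat) (u v : 'rV['F_p]_n) : 'F_p :=
  \sum_(i < n) u 0 i * v 0 i.

(* An element of 'F_p is used as an exponent through its representative in
   {0, ..., p-1}; this is harmless for p prime, as zeta then has order p. *)
Definition walsh (R : realType) (p n : nat) (f : 'rV['F_p]_n -> 'F_p)
    (a : 'rV['F_p]_n) : R[i] :=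
  \sum_(x : 'rV['F_p]_n) zeta R p ^+ nat_of_ord (f x - scalar_product a x).

Definition plateaued (R : realType) (p n t : nat)
    (f : 'rV['F_p]_n -> 'F_p) : Prop :=
  forall a : 'rV['F_p]_n,
    normc (walsh R f a) = 0 \/
    normc (walsh R f a) = (p%:R : R) `^ ((n + t)%:R / 2).

Definition component (p n : nat) (F : 'rV['F_p]_n -> 'rV['F_p]_n)
    (b x : 'rV['F_p]_n) : 'F_p :=
  scalar_product b (F x).

Definition vectorial_plateaued (R : realType) (p n t : nat)
    (F : 'rV['F_p]_n -> 'rV['F_p]_n) : Prop :=
  forall b : 'rV['F_p]_n, b != 0 -> plateaued R t (component F b).

Definition num_sols (p n : nat) (F : 'rV['F_p]_n -> 'rV['F_p]_n)
    (a b : 'rV['F_p]_n) : nat :=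
  #|[set x : 'rV['F_p]_n | F (x + a) - F x == b]|.

Definition diff_uniformity (p n : nat)
    (F : 'rV['F_p]_n -> 'rV['F_p]_n) : nat :=
  \max_(a : 'rV['F_p]_n | a != 0) \max_(b : 'rV['F_p]_n) num_sols F a b.

(* Main.v *)
(** Write N(a, y) for the number of solutions of F(x + a) - F(x) = y.  Parseval
    applied to |W_f|^2, the Fourier transform of the autocorrelation of
    zeta^f, gives the fourth moment of the Walsh spectrum of each component;
    plateauedness makes it p^(n+t) times the second moment.  Summing over all
    components and applying Parseval in the dual variable yields, over
    a <> 0 and all y, the identity sum N^2 = p^t sum N, that is,
    sum N (p^t - N) = 0.  As sum N > 0, some N is at least p^t; and if no N
    exceeds p^t then every summand vanishes. *)

Require Import Defs.
From mathcomp Require Import all_boot all_order all_algebra.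
From mathcomp Require Import complex.
From mathcomp Require Import reals exp trigo.
From mathcomp Require Import zify.

Set Implicit Arguments.
Unset Strict Implicit.
Unset Printing Implicit Defensive.

Import Order.TTheory GRing.Theory Num.Theory.
Local Open Scope ring_scope.

Section ScalarProduct.
Variables (p n : nat).
Implicit Types u v w : 'rV['F_p]_n.

Lemma scalar_productC u v : scalar_product u v = scalar_product v u.
Proof. by apply: eq_bigr => i _; rewrite mulrC. Qed.

Lemma scalar_productDr u v w :
  scalar_product u (v + w) = scalar_product u v + scalar_product u w.
Proof. by rewrite -big_split; apply: eq_bigr => i _; rewrite mxE mulrDr. Qed.

Lemma scalar_productNr u v : scalar_product u (- v) = - scalar_product u v.
Proof. by rewrite -sumrN; apply: eq_bigr => i _; rewrite mxE mulrN. Qed.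

Lemma scalar_productBr u v w :
  scalar_product u (v - w) = scalar_product u v - scalar_product u w.
Proof. by rewrite scalar_productDr scalar_productNr. Qed.

Lemma scalar_productDl u v w :
  scalar_product (u + v) w = scalar_product u w + scalar_product v w.
Proof. by rewrite !(scalar_productC _ w) scalar_productDr. Qed.

Lemma scalar_productNl u v : scalar_product (- u) v = - scalar_product u v.
Proof. by rewrite !(scalar_productC _ v) scalar_productNr. Qed.

Lemma scalar_product0r u : scalar_product u 0 = 0.
Proof. by apply: big1 => i _; rewrite mxE mulr0. Qed.

Lemma scalar_product0l u : scalar_product 0 u = 0.
Proof. by rewrite scalar_productC scalar_product0r. Qed.

Lemma scalar_product_eq1 u : u != 0 -> exists v, scalar_product v u = 1.
Proof.
case/rV0Pn => i ui0; exists ((u 0 i)^-1 *: delta_mx 0 i).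
rewrite /scalar_product (bigD1 i) //= big1 => [|j ji].
  by rewrite !mxE !eqxx mulr1 addr0 mulVf.
by rewrite !mxE (negPf ji) mulr0 mul0r.
Qed.

End ScalarProduct.

(** * The canonical additive character of the prime field *)

Section AdditiveCharacter.
Variables (R : realType) (p : nat).
Hypothesis p_pr : prime p.

Definition chi (u : 'F_p) : R[i] := zeta R p ^+ nat_of_ord u.

Lemma de_Moivre (x : R) k :
  (cos x +i* sin x)%C ^+ k = (cos (x *+ k) +i* sin (x *+ k))%C.
Proof.
elim: k => [|k IHk]; first by rewrite expr0 mulr0n cos0 sin0.
by rewrite exprS IHk mulrS cosD sinD; congr (_ +i* _)%C; rewrite addrC.
Qed.

Lemma zeta_expp : zeta R p ^+ p = 1.
Proof.
have p0 : p%:R != 0 :> R by rewrite pnatr_eq0 -lt0n prime_gt0.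
rewrite de_Moivre -[_ *+ p]mulr_natr divfK // mulr_natl cos2pi.
by rewrite mulr2n sinD sinpi mul0r mulr0 addr0.
Qed.

(** As p >= 2, the angle 2 pi / p lies in ]0, pi], where the injectivity of cos on [0, pi] excludes
    real part 1. *)
Lemma zeta_neq1 : zeta R p != 1.
Proof.
apply/eqP => /(congr1 (@complex.Re R)) /= cos_eq1.
have p_gt0 : 0 < p%:R :> R by rewrite ltr0n prime_gt0.
have pi_gt0 := pi_gt0 R.
have angle_gt0 : 0 < 2 * pi / p%:R :> R by rewrite divr_gt0 ?mulr_gt0.
have angle_le : 2 * pi / p%:R <= pi :> R.
  by rewrite ler_pdivrMr // mulrC ler_pM2l // ler_nat prime_gt1.
suff angle0 : 2 * pi / p%:R = 0 :> R by rewrite angle0 ltxx in angle_gt0.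
by apply: cos_inj; rewrite ?cos0 // in_itv /= ?lexx ltW.
Qed.

Lemma chi0 : chi 0 = 1.
Proof. by []. Qed.

(** Adding in ['F_p] reduces the representatives mod p, which [zeta_expp] makes invisible in the
    exponent. *)
Lemma chiD u v : chi (u + v) = chi u * chi v.
Proof.
rewrite /chi -exprD /= -[in RHS](expr_mod _ zeta_expp).
by rewrite [X in (_ %% X)%N]Fp_cast.
Qed.

Lemma chiNK u : chi (- u) * chi u = 1.
Proof. by rewrite -chiD addNr. Qed.

Lemma norm_chi u : `|chi u| = 1.
Proof.
by rewrite normrX /zeta /Num.norm /= cos2Dsin2 sqrtr1 expr1n.
Qed.

Lemma conj_chi u : (chi u)^* = chi (- u).
Proof.
have : chi u * (chi u)^* = 1 by rewrite -normCK norm_chi expr1n.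
by move/(congr1 ( *%R (chi (- u)))); rewrite mulrA chiNK mul1r mulr1.
Qed.

Lemma chi1_neq1 : chi 1 != 1.
Proof. by rewrite /chi /= modn_small // zeta_neq1. Qed.

(** * Fourier transform and Parseval's identity *)

Variable n : nat.
Implicit Types (c u x y : 'rV['F_p]_n) (G : 'rV['F_p]_n -> R[i]).

(** For x <> 0, translating c by some v with v.x = 1 multiplies the sum by chi 1 <> 1, so the sum
    vanishes. *)
Lemma chi_orthogonal x :
  \sum_c chi (scalar_product c x) = if x == 0 then (p ^ n)%:R else 0.
Proof.
have [-> | x0] := eqVneq.
  under eq_bigr do rewrite scalar_product0r chi0.
  by rewrite sumr_const card_mx card_Fp // mul1n.
have [v vx] := scalar_product_eq1 x0.
apply/eqP; set S := \sum_c _.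
have : chi 1 * S = S.
  rewrite /S mulr_sumr [RHS](reindex_inj (addrI v)).
  by apply: eq_bigr => c _; rewrite scalar_productDl vx chiD.
move/eqP; rewrite -subr_eq0 -[X in _ - X]mul1r -mulrBl mulf_eq0 subr_eq0.
by rewrite (negPf chi1_neq1).
Qed.

Definition fourier G c : R[i] := \sum_x G x * chi (- scalar_product c x).

(** Expanding the squares leaves, for each pair x, y, a character sum at y - x; orthogonality keeps
    only the diagonal. *)
Lemma parseval G :
  \sum_c `|fourier G c| ^+ 2 = (p ^ n)%:R * \sum_x `|G x| ^+ 2.
Proof.
transitivity (\sum_x \sum_y G x * (G y)^* *
                \sum_c chi (scalar_product c (y - x))).
  under eq_bigr => c _.
    rewrite normCK /fourier rmorph_sum mulr_suml.
    under eq_bigr do rewrite mulr_sumr.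
    over.
  rewrite exchange_big; apply: eq_bigr => x _.
  rewrite exchange_big; apply: eq_bigr => y _.
  rewrite mulr_sumr; apply: eq_bigr => c _.
  rewrite rmorphM /= conj_chi opprK scalar_productBr chiD.
  by rewrite mulrACA [chi _ * chi _]mulrC.
rewrite mulr_sumr; apply: eq_bigr => x _.
under eq_bigr do rewrite chi_orthogonal subr_eq0.
rewrite (bigD1 x) //= big1 => [|y /negPf->]; last by rewrite mulr0.
by rewrite eqxx addr0 normCK mulrC.
Qed.

(** * Autocorrelation and moments of the Walsh spectrum *)

Definition autocorrelation (f : 'rV['F_p]_n -> 'F_p) a : R[i] :=
  \sum_x chi (f (x + a) - f x).

Lemma autocorrelation0 f : autocorrelation f 0 = (p ^ n)%:R.
Proof.
rewrite /autocorrelation; under eq_bigr do rewrite addr0 subrr chi0.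
by rewrite sumr_const card_mx card_Fp // mul1n.
Qed.

Lemma walsh_fourier f c : walsh R f c = fourier (chi \o f) c.
Proof. by apply: eq_bigr => x _; rewrite -chiD. Qed.

(** In the double sum for W times its conjugate, writing the first variable as x + a collects the
    terms by the shift a. *)
Lemma sqr_norm_walsh f c :
  `|walsh R f c| ^+ 2 = fourier (autocorrelation f) c.
Proof.
rewrite normCK walsh_fourier /fourier /autocorrelation.
under [RHS]eq_bigr do rewrite mulr_suml.
rewrite exchange_big rmorph_sum mulr_sumr /=; apply: eq_bigr => x _.
rewrite mulr_suml (reindex_inj (addrI x)); apply: eq_bigr => a _.
rewrite rmorphM /= !conj_chi opprK -!chiD scalar_productDr.
by congr chi; rewrite opprD addrACA [- _ - _ + _]addrAC addNr add0r.
Qed.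

(** Both admissible values of |W|^2, namely 0 and p^(n+t), are roots of X^2 = p^(n+t) X. *)
Lemma plateaued_norm t f c : plateaued R t f ->
  `|walsh R f c| ^+ 4 = (p ^ (n + t))%:R * `|walsh R f c| ^+ 2.
Proof.
move=> /(_ c) Hf; rewrite (exprM _ 2 2).
have -> : `|walsh R f c| = (ComplexField.Normc.normc (walsh R f c))%:C%C by [].
case: Hf => ->; first by rewrite !expr0n mulr0.
rewrite -[in LHS]rmorphXn -!rmorphXn /=.
have -> : ((p%:R : R) `^ ((n + t)%:R / 2)) ^+ 2 = (p ^ (n + t))%:R.
  rewrite -powR_mulrn ?powR_ge0 // -powRrM divfK ?pnatr_eq0 //.
  by rewrite powR_mulrn // natrX.
by rewrite expr2 rmorphM /= rmorph_nat.
Qed.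

(** By Parseval, p^n times the left side is the fourth Walsh moment, hence p^(n+t) times the second
    one, which is p^n * p^n by Parseval again. *)
Lemma plateaued_autocorrelation t f : plateaued R t f ->
  \sum_a `|autocorrelation f a| ^+ 2 = (p ^ (n + t) * p ^ n)%:R.
Proof.
move=> Hf; have pn0 : (p ^ n)%:R != 0 :> R[i].
  by rewrite pnatr_eq0 -lt0n expn_gt0 prime_gt0.
apply: (mulfI pn0); rewrite -parseval.
transitivity (\sum_c (p ^ (n + t))%:R * `|walsh R f c| ^+ 2).
  apply: eq_bigr => c _; rewrite -sqr_norm_walsh -(plateaued_norm _ Hf).
  by rewrite normrX normr_id -exprM.
rewrite -mulr_sumr; under eq_bigr do rewrite walsh_fourier.
rewrite parseval; under eq_bigr do rewrite norm_chi expr1n.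
by rewrite sumr_const card_mx card_Fp // mul1n natrM mulrCA.
Qed.

(** * Second moment of the solution counts *)

Variable F : 'rV['F_p]_n -> 'rV['F_p]_n.

(** The points x are grouped by the value y of F(x + a) - F(x). The sign of b compensates for the
    one in [fourier]. *)
Lemma autocorrelation_component b a :
  autocorrelation (component F b) a
    = fourier (fun y => (num_sols F a y)%:R) (- b).
Proof.
rewrite /autocorrelation /fourier.
rewrite (partition_big (fun x => F (x + a) - F x) predT) //=.
apply: eq_bigr => y _; rewrite scalar_productNl opprK.
rewrite (eq_bigr (fun=> chi (scalar_product b y))) => [|x /eqP <-].
  by rewrite sumr_const mulr_natl /num_sols cardsE.
by rewrite scalar_productBr.
Qed.

Lemma sum_autocorrelation_component a :
  \sum_b `|autocorrelation (component F b) a| ^+ 2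
    = (p ^ n)%:R * \sum_y (num_sols F a y)%:R ^+ 2.
Proof.
rewrite (reindex_inj oppr_inj).
under eq_bigr do rewrite autocorrelation_component opprK.
by rewrite parseval; under eq_bigr do rewrite normr_nat.
Qed.

Lemma sum_num_sols a : (\sum_y num_sols F a y = p ^ n)%N.
Proof.
transitivity #|{: 'rV['F_p]_n}|; last by rewrite card_mx card_Fp // mul1n.
rewrite -[RHS]sum1_card.
rewrite [RHS](partition_big (fun x => F (x + a) - F x) predT) //=.
by apply: eq_bigr => y _; rewrite sum1dep_card.
Qed.

Lemma sum_sqr_num_sols t : vectorial_plateaued R t F ->
  (\sum_(a | a != 0%R) \sum_y num_sols F a y ^ 2
     = p ^ t * \sum_(a | a != 0%R) \sum_y num_sols F a y)%N.
Proof.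
have q0 : (p ^ n)%:R != 0 :> R[i].
  by rewrite pnatr_eq0 -lt0n expn_gt0 prime_gt0.
move=> HF; apply/eqP; rewrite -(eqr_nat R[i]) -(inj_eq (mulfI q0)); apply/eqP.
(* This double sum is evaluated twice: first over b for fixed a, then over a for fixed b. *)
transitivity (\sum_b \sum_(a | a != 0)
                `|autocorrelation (component F b) a| ^+ 2).
  rewrite [RHS]exchange_big natr_sum mulr_sumr /=; apply: eq_bigr => a _.
  rewrite sum_autocorrelation_component natr_sum.
  by under eq_bigr do rewrite natrX.
(* The component at b = 0 is constant, so its autocorrelation is p^n at every a. *)
rewrite (bigD1 0) //= (eq_bigr (fun=> (p ^ n)%:R ^+ 2)) => [|a _]; last first.
  rewrite /autocorrelation.
  under eq_bigr do rewrite /component !scalar_product0l subrr chi0.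
  by rewrite sumr_const card_mx card_Fp // mul1n normr_nat.
(* For b <> 0 the full sum over a is known; its term at a = 0, equal to p^(2n), is removed. *)
rewrite [X in _ + X](eq_bigr (fun=> (p ^ (n + t) * p ^ n)%:R - (p ^ n)%:R ^+ 2))
  => [|b b0]; last first.
  rewrite -(plateaued_autocorrelation (HF b b0)) [in RHS](bigD1 0) //=.
  by rewrite autocorrelation0 normr_nat addrC addrK.
under [X in _ = _ * (_ * X)%:R]eq_bigr do rewrite sum_num_sols.
(* There are as many nonzero a as nonzero b, so the contributions p^(2n) cancel. *)
rewrite !sumr_const -mulrnDl addrC subrK expnD.
by rewrite -mulrnA -[(p ^ n)%N *+ _]mulr_natr natn -natrM; congr (_%:R); lia.
Qed.

End AdditiveCharacter.

Theorem theorem5p6 (R : realType) (p n t : nat)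
    (F : 'rV['F_p]_n -> 'rV['F_p]_n) :
  prime p -> (0 < n)%N -> (0 < t)%N ->
  vectorial_plateaued R t F ->
  (p ^ t <= diff_uniformity F)%N /\
  (diff_uniformity F = (p ^ t)%N <->
   forall a b : 'rV['F_p]_n, a != 0 ->
     num_sols F a b = 0%N \/ num_sols F a b = (p ^ t)%N).
Proof.
move=> p_pr n_gt0 _ HF.
have sum_sqr := sum_sqr_num_sols p_pr HF.
have T_gt0 : (0 < p ^ t)%N by rewrite expn_gt0 prime_gt0.
have le_diff a b : a != 0 -> (num_sols F a b <= diff_uniformity F)%N.
  move=> a0; rewrite /diff_uniformity (bigD1 a) //=.
  by rewrite leq_max (bigD1 b) //= leq_max leqnn.
(* If no N exceeds p^t, then N^2 <= p^t N termwise; since the sums agree, a strict inequality at one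
   pair is impossible. *)
have le_cases a b : a != 0 -> (diff_uniformity F <= p ^ t)%N ->
    num_sols F a b = 0%N \/ num_sols F a b = (p ^ t)%N.
  move=> a0 diff_le.
  have term_le c d : c != 0 -> (num_sols F c d ^ 2 <= p ^ t * num_sols F c d)%N.
    by move=> c0; rewrite leq_mul2r (leq_trans (le_diff c d c0)) ?orbT.
  suff /eqP : (num_sols F a b ^ 2 == p ^ t * num_sols F a b)%N by nia.
  rewrite eqn_leq term_le //= leqNgt; apply/negP => lt_ab.
  suff : (\sum_(c | c != 0%R) \sum_d num_sols F c d ^ 2
          < p ^ t * \sum_(c | c != 0%R) \sum_d num_sols F c d)%N.
    by rewrite sum_sqr ltnn.
  rewrite big_distrr /= (bigD1 a) //= [X in (_ < X)%N](bigD1 a) //=.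
  rewrite -addSn leq_add //; last first.
    by apply: leq_sum => c /andP[c0 _]; rewrite big_distrr leq_sum // => d _;
       exact: term_le.
  rewrite big_distrr /= (bigD1 b) //= [X in (_ < X)%N](bigD1 b) //=.
  by rewrite -addSn leq_add // leq_sum // => d _; exact: term_le.
(* A maximum below p^t would leave only the value 0 for every N, whereas the counts for a fixed
   nonzero a add up to p^n. *)
have diff_ge : (p ^ t <= diff_uniformity F)%N.
  rewrite leqNgt; apply/negP => diff_lt.
  (* The all-ones vector is a nonzero shift because n > 0. *)
  pose a : 'rV['F_p]_n := const_mx 1.
  have a0 : a != 0 by apply/rV0Pn; exists (Ordinal n_gt0); rewrite mxE oner_eq0.
  have := sum_num_sols p_pr F a; rewrite big1 => [|b _].
    by move/esym/eqP; rewrite expn_eq0 -leqn0 leqNgt prime_gt0.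
  have [//|N_eq] := le_cases a b a0 (ltnW diff_lt).
  by have := le_diff a b a0; rewrite N_eq leqNgt diff_lt.
split=> //; split=> [diff_eq a b a0 | N_cases].
  by apply: le_cases; rewrite ?diff_eq.
apply/eqP; rewrite eqn_leq diff_ge andbT.
apply/bigmax_leqP => a a0; apply/bigmax_leqP => b _.
by have [-> | ->] := N_cases a b a0.
Qed.
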